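(* Let $\lambda,\mu\in\mathbb{C}$ and let $P$ be a simple $\mathcal{G}_{\lambda,\mu}$-module. The following conditions are equivalent: (1) There exists $t\in\mathbb{Z}_+$ such that the action of $L_t$ on $P$ is locally finite. (2) There exists $t\in\mathbb{Z}_+$ such that the action of $L_t$ on $P$ is locally nilpotent. (3) There exist $x,y,z\in\mathbb{Z}$ such that the action of $\mathcal{G}_{\lambda,\mu}^{(x,y,z)}$ on $P$ is locally finite. (4) There exist $x,y,z\in\mathbb{Z}$ such that the action of $\mathcal{G}_{\lambda,\mu}^{(x,y,z)}$ on $P$ is locally nilpotent. (5) $P$ is restricted.
   Context: $\mathbb{N}$ denotes the nonnegative integers and $\mathbb{Z}_+$ the positive integers. For $\lambda,\mu\in\mathbb{C}$, $\mathcal{G}_{\lambda,\mu}$ (the deformative Schrödinger–Virasoro algebra) is the complex Lie algebra with basis $\{L_m, M_m, Y_{m-\frac12}, C\mid m\in\mathbb{Z}\}$ and brackets, for $m,n\in\mathbb{Z}$, $$[L_m,L_n]=(n-m)L_{m+n}+\delta_{m+n,0}\tfrac{m^3-m}{12}C,\quad [L_m,Y_{n-\frac12}]=\Big(n-\tfrac{\lambda+1}{2}m+\mu-\tfrac12\Big)Y_{m+n-\frac12},$$ $$[Y_{m-\frac12},Y_{n-\frac12}]=(m-n)M_{m+n-1},\quad [L_m,M_n]=(n-\lambda m+2\mu)M_{m+n},$$ $$[M_m,M_n]=[M_m,Y_{n-\frac12}]=[\mathcal{G}_{\lambda,\mu},C]=0.$$ Throughout, $C$ is assumed to act on modules as a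 scalar $c\in\mathbb{C}$. For $x,y,z\in\mathbb{Z}$, $\mathcal{G}_{\lambda,\mu}^{(x,y,z)}$ denotes the span of all $M_{x+i}$, $Y_{y+i-\frac12}$, $L_{z+i}$ with $i\in\mathbb{N}$. An element $u$ acts locally nilpotently on a module $P$ if for every $v\in P$ there is $n\in\mathbb{Z}_+$ with $u^nv=0$; it acts locally finitely if for every $v\in P$, $\dim\big(\sum_{n\in\mathbb{Z}_+}\mathbb{C}u^nv\big)<\infty$. For a subspace $\mathcal{S}$ of the Lie algebra, let $\mathcal{S}^nv$ be the span of all $s_1s_2\cdots s_nv$ with $s_1,\dots,s_n\in\mathcal{S}$. The action of $\mathcal{S}$ on $P$ is locally nilpotent if for every $v\in P$ there is $n\in\mathbb{Z}_+$ with $\mathcal{S}^nv=0$, and locally finite if for every $v\in P$, $\dim\big(\sum_{n\in\mathbb{Z}_+}\mathcal{S}^nv\big)<\infty$. The algebra is $\frac12\mathbb{Z}$-graded, $\mathcal{G}_{\lambda,\mu}=\bigoplus_{r\in\frac12\mathbb{Z}}\mathcal{G}_{\lambda,\mu}^{(r)}$, where $L_m,M_m$ have degree $m$, $Y_{m-\frac12}$ has degree $m-\frac12$, and $C$ has degree $0$. A $\mathcal{G}_{\lambda,\mu}$-module $P$ is restricted if for every $v\in P$ there exists $n\in\mathbb{N}$ such that $\mathcal{G}_{\lambda,\mu}^{(n+i)}v=0$ for all $i\in\frac12\mathbb{Z}_+$. *)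

(* Defs.v *)
From HB Require Import structures.
From mathcomp Require Import all_boot all_order all_algebra.
From mathcomp Require Import finmap monalg.
From mathcomp Require Import classical_sets reals complex.
From mathcomp Require Import ring.

Set Implicit Arguments.
Unset Strict Implicit.
Unset Printing Implicit Defensive.

Import Order.TTheory GRing.Theory Num.Theory.
Local Open Scope ring_scope.
Local Open Scope classical_set_scope.

Section Subspaces.
Variables (K : fieldType) (V : lmodType K).

Definition lspan (S : set V) : set V :=
  [set v | exists (n : nat) (a : 'I_n -> K) (s : 'I_n -> V),
     (forall i, S (s i)) /\ v = \sum_(i < n) a i *: s i].

Definition fin_dim (W : set V) : Prop :=
  exists s : seq V, W = lspan [set` s].

End Subspaces.

HB.mixin Record Lmodule_isLieAlgebra (K : fieldType) V of GRing.Lmodule K V := {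
  lie : V -> V -> V;
  lie_linearl : forall y, linear (fun x => lie x y);
  lie_linearr : forall x, linear (lie x);
  liexx : forall x, lie x x = 0;
  lie_jacobi : forall x y z,
    lie x (lie y z) + lie y (lie z x) + lie z (lie x y) = 0
}.

#[short(type="lieAlgType")]
HB.structure Definition LieAlgebra (K : fieldType) :=
  { V of GRing.Lmodule K V & Lmodule_isLieAlgebra K V }.

Record lieModule (K : fieldType) (g : lieAlgType K) (P : lmodType K) :=
  LieModule {
    lie_act :> g -> P -> P;
    lie_act_linearl : forall v, linear (fun x => lie_act x v);
    lie_act_linearr : forall x, linear (lie_act x);
    lie_act_bracket : forall x y v,
      lie_act (lie x y) v = lie_act x (lie_act y v) - lie_act y (lie_act x v)
  }.

Section LieModules.
Variables (K : fieldType) (g : lieAlgType K) (P : lmodType K).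
Variable rho : lieModule g P.

Definition lie_submodule (N : set P) : Prop :=
  [/\ N 0, forall a u v, N u -> N v -> N (a *: u + v)
    & forall x v, N v -> N (rho x v)].

Definition simple_lie_module : Prop :=
  (exists v : P, v != 0) /\
  forall N : set P, lie_submodule N -> N = [set 0] \/ N = setT.

Definition elt_locally_nilpotent (u : g) : Prop :=
  forall v, exists2 n, (0 < n)%N & iter n (rho u) v = 0.

(* The span of a family of vectors is the sum of the lines they generate. *)
Definition elt_locally_finite (u : g) : Prop :=
  forall v, fin_dim (lspan [set iter n (rho u) v | n in [set n | (0 < n)%N]]).

Definition act_pow (S : set g) (n : nat) (v : P) : set P :=
  lspan [set w | exists s : n.-tuple g,
     (forall i, S (tnth s i)) /\ w = foldr (fun x u => rho x u) v s].

Definition locally_nilpotent (S : set g) : Prop :=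
  forall v, exists2 n, (0 < n)%N & act_pow S n v = [set 0].

(* The sum of a family of subspaces is the span of their union. *)
Definition locally_finite (S : set g) : Prop :=
  forall v, fin_dim (lspan (\bigcup_(n in [set n | (0 < n)%N]) act_pow S n v)).

End LieModules.

(* [GenY m] is the index of Y_{m - 1/2}. *)
Variant sv_gen := GenL of int | GenM of int | GenY of int | GenC.

Definition sv_gen_code (k : sv_gen) : int + int + int + unit :=
  match k with
  | GenL m => inl (inl (inl m))
  | GenM m => inl (inl (inr m))
  | GenY m => inl (inr m)
  | GenC => inr tt
  end.

Definition sv_gen_decode (s : int + int + int + unit) : sv_gen :=
  match s with
  | inl (inl (inl m)) => GenL m
  | inl (inl (inr m)) => GenM m
  | inl (inr m) => GenY m
  | inr _ => GenC
  end.

Lemma sv_gen_codeK : cancel sv_gen_code sv_gen_decode.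
Proof. by case. Qed.

HB.instance Definition _ := Countable.copy sv_gen (can_type sv_gen_codeK).

Section LinearExtension.
Variables (K : fieldType) (I : choiceType) (V : lmodType K).

Definition lext (f : I -> V) (x : {malg K[I]}) : V :=
  \sum_(k <- msupp x) x@_k *: f k.

Lemma lextE (f : I -> V) (x : {malg K[I]}) :
  lext f x = \sum_(k <- msupp x) x@_k *: f k.
Proof. by []. Qed.

Lemma lextEw (f : I -> V) (d : {fset I}) (x : {malg K[I]}) :
  (msupp x `<=` d)%fset -> lext f x = \sum_(k <- d) x@_k *: f k.
Proof.
move=> sxd; rewrite /lext (big_fset_incl _ sxd) // => k _ kx.
by rewrite mcoeff_outdom // scale0r.
Qed.

Lemma lext_linear (f : I -> V) : linear (lext f).
Proof.
move=> a x y; pose d := (msupp (a *: x + y) `|` (msupp x `|` msupp y))%fset.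
have sxy : (msupp x `|` msupp y `<=` d)%fset by exact: fsubsetUr.
rewrite (@lextEw f d (a *: x + y)); last exact: fsubsetUl.
rewrite (@lextEw f d x); last exact: fsubset_trans (fsubsetUl _ _) sxy.
rewrite (@lextEw f d y); last exact: fsubset_trans (fsubsetUr _ _) sxy.
rewrite scaler_sumr -big_split; apply: eq_bigr => k _ /=.
by rewrite mcoeffD mcoeffZ scalerDl scalerA.
Qed.

Lemma lextU (f : I -> V) k : lext f << k >> = f k.
Proof.
rewrite (@lextEw f [fset k]%fset) ?msuppU_le //.
by rewrite big_seq_fset1 mcoeffUU scale1r.
Qed.

End LinearExtension.

Lemma malg_linear_ind (K : fieldType) (I : choiceType)
    (Q : {malg K[I]} -> Prop) :
  Q 0 -> (forall a x y, Q x -> Q y -> Q (a *: x + y)) ->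
  (forall k, Q << k >>) -> forall x, Q x.
Proof.
move=> Q0 Ql QU x; rewrite (monalgE x).
elim/big_ind: _ => // [u v Qu Qv|k _].
  by rewrite -[u]scale1r; exact: Ql.
have -> : << x@_k *g k >> = x@_k *: << k >> + 0 :> {malg K[I]}.
  apply/malgP => j; rewrite addr0 mcoeffZ !mcoeffU.
  by case: (k == j); rewrite ?mulr1n ?mulr0n ?mulr1 ?mulr0.
exact: Ql.
Qed.

Section BracketTable.
Variables (K : numFieldType) (lambda mu : K) (V : lmodType K) (e : sv_gen -> V).

(* [e] is the basis. It ranges over the families of an arbitrary module because
   the Lie algebra axioms are far too slow to check in {malg K[sv_gen]} itself. *)
Definition sv_bracket_table (a b : sv_gen) : V :=
  let cLY (m n : int) :=
    n%:~R - (lambda + 1) / 2 * m%:~R + mu - 1 / 2 in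
  let cLM (m n : int) := n%:~R - lambda * m%:~R + 2 * mu in
  match a, b with
  | GenL m, GenL n =>
      (n - m)%:~R *: e (GenL (m + n)) +
      (if m + n == 0 then (m%:~R ^+ 3 - m%:~R) / 12 else 0) *: e GenC
  | GenL m, GenY n => cLY m n *: e (GenY (m + n))
  | GenY n, GenL m => - (cLY m n *: e (GenY (m + n)))
  | GenY m, GenY n => (m - n)%:~R *: e (GenM (m + n - 1))
  | GenL m, GenM n => cLM m n *: e (GenM (m + n))
  | GenM n, GenL m => - (cLM m n *: e (GenM (m + n)))
  | _, _ => 0
  end.

Lemma sv_bracket_table_anti a b :
  sv_bracket_table a b = - sv_bracket_table b a.
Proof.
case: a b => [m|m|m|] [n|n|n|] //=; rewrite ?opprK ?oppr0 //; last first.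
  have -> : n - m = - (m - n) by ring.
  by rewrite intrN scaleNr opprK [n + m]addrC.
have -> : n - m = - (m - n) by ring.
rewrite [n + m]addrC intrN [RHS]opprD -!scaleNr; congr (_ + _ *: _).
case: eqP => [mn0|_]; last by rewrite oppr0.
have -> : n = - m by apply/eqP; rewrite -addr_eq0 addrC mn0.
by rewrite intrN; ring.
Qed.

Variable br : V -> V -> V.
Hypothesis br_linearl : forall y, linear (fun x => br x y).
Hypothesis br_linearr : forall x, linear (br x).
Hypothesis brE : forall a b, br (e a) (e b) = sv_bracket_table a b.
Hypothesis e_ind : forall Q : V -> Prop,
  Q 0 -> (forall a x y, Q x -> Q y -> Q (a *: x + y)) ->
  (forall k, Q (e k)) -> forall x, Q x.

Let br0l y : br 0 y = 0.
Proof.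
have := br_linearl y (-1) 0 0.
by rewrite scaler0 addr0 scaleN1r addNr.
Qed.

Let br0r x : br x 0 = 0.
Proof.
have := br_linearr x (-1) 0 0.
by rewrite scaler0 addr0 scaleN1r addNr.
Qed.

Let brZr x a y : br x (a *: y) = a *: br x y.
Proof. by have := br_linearr x a y 0; rewrite br0r !addr0. Qed.

Let brDr x y z : br x (y + z) = br x y + br x z.
Proof. by have := br_linearr x 1 y z; rewrite !scale1r. Qed.

Let brNr x y : br x (- y) = - br x y.
Proof. by rewrite -scaleN1r brZr scaleN1r. Qed.

Let br_anti x y : br x y = - br y x.
Proof.
elim/e_ind: x => [|a u v IHu IHv|a].
- by rewrite br0l br0r oppr0.
- by rewrite br_linearl br_linearr IHu IHv opprD scalerN.
elim/e_ind: y => [|b u v IHu IHv|b].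
- by rewrite br0l br0r oppr0.
- by rewrite br_linearl br_linearr IHu IHv opprD scalerN.
by rewrite !brE sv_bracket_table_anti.
Qed.

Lemma brxx x : br x x = 0.
Proof.
have /eqP := br_anti x x; rewrite -addr_eq0 -mulr2n -scaler_nat.
by rewrite scaler_eq0 pnatr_eq0 /= => /eqP.
Qed.

Let jac x y z := br x (br y z) + br y (br z x) + br z (br x y).

Let jac_cycle x y z : jac x y z = jac y z x.
Proof. by rewrite /jac -addrA addrC. Qed.

Let jac_linear y z : linear (fun x => jac x y z).
Proof.
move=> a u v; rewrite /jac !(br_linearl, br_linearr) !scalerDr.
by rewrite [X in X + _ = _]addrACA [LHS]addrACA.
Qed.

Let jac0 y z : jac 0 y z = 0.
Proof. by rewrite /jac !(br0l, br0r) !addr0. Qed.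

Let jacE a b c : jac (e a) (e b) (e c) = 0.
Proof.
have LLL m n p : jac (e (GenL m)) (e (GenL n)) (e (GenL p)) = 0.
  rewrite /jac !brE /= !(brDr, brZr, brE) /= !scaler0 !addr0.
  have -> : n + (p + m) = m + (n + p) by ring.
  have -> : p + (m + n) = m + (n + p) by ring.
  rewrite !scalerDr !scalerA.
  rewrite [X in X + _ = _]addrACA [LHS]addrACA -!scalerDl.
  rewrite [X in X *: _ + _](_ : _ = 0); last by rewrite !(intrD, intrN); ring.
  rewrite [X in _ + X *: _](_ : _ = 0) ?scale0r ?addr0 //.
  case: eqP => [mnp|_]; last by rewrite !mulr0 !addr0.
  have -> : p = - m - n by rewrite -[RHS]addr0 -mnp; ring.
  by rewrite !(intrD, intrN); field.
have LLM m n p : jac (e (GenL m)) (e (GenL n)) (e (GenM p)) = 0.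
  rewrite /jac !brE /= !(brNr, brDr, brZr, brE) /=.
  have -> : n + (m + p) = m + (n + p) by ring.
  have -> : m + n + p = m + (n + p) by ring.
  rewrite !scaler0 addr0 !scalerN !scalerA -!scaleNr -!scalerDl.
  by rewrite [X in X *: _](_ : _ = 0) ?scale0r // !(intrD, intrN); ring.
have LLY m n p : jac (e (GenL m)) (e (GenL n)) (e (GenY p)) = 0.
  rewrite /jac !brE /= !(brNr, brDr, brZr, brE) /=.
  have -> : n + (m + p) = m + (n + p) by ring.
  have -> : m + n + p = m + (n + p) by ring.
  rewrite !scaler0 addr0 !scalerN !scalerA -!scaleNr -!scalerDl.
  by rewrite [X in X *: _](_ : _ = 0) ?scale0r // !(intrD, intrN); field.
have LYY m n p : jac (e (GenL m)) (e (GenY n)) (e (GenY p)) = 0.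
  rewrite /jac !brE /= !(brNr, brDr, brZr, brE) /=.
  have -> : n + (m + p) - 1 = m + (n + p - 1) by ring.
  have -> : p + (m + n) - 1 = m + (n + p - 1) by ring.
  rewrite ?scalerN !scalerA -!scaleNr -!scalerDl.
  by rewrite [X in X *: _](_ : _ = 0) ?scale0r // !(intrD, intrN); field.
have cyc f g h : jac (e g) (e h) (e f) = 0 -> jac (e f) (e g) (e h) = 0.
  by rewrite -jac_cycle.
case: a b c => [m|m|m|] [n|n|n|] [p|p|p|];
  first [ exact: LLL | exact: LLM | exact: LLY | exact: LYY
        | exact: cyc (LLM _ _ _) | exact: cyc (LLY _ _ _)
        | exact: cyc (LYY _ _ _) | exact: cyc (cyc _ _ _ (LLM _ _ _))
        | exact: cyc (cyc _ _ _ (LLY _ _ _))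
        | exact: cyc (cyc _ _ _ (LYY _ _ _))
        | by rewrite /jac !brE /= ?(brNr, brDr, brZr, brE, br0r) /=
                     ?(scaler0, oppr0, br0r, addr0) ].
Qed.

Lemma br_jacobi x y z : jac x y z = 0.
Proof.
have step u v : (forall k, jac (e k) u v = 0) -> forall w, jac w u v = 0.
  move=> eQ w; elim/e_ind: w => // a s t IHs IHt.
  by rewrite jac_linear IHs IHt scaler0 addr0.
apply: (step) => a; rewrite jac_cycle; apply: (step) => b.
by rewrite jac_cycle; apply: (step) => c; exact: jacE.
Qed.

End BracketTable.

Section SchrodingerVirasoro.
Variables (K : numFieldType) (lambda mu : K).

Definition sv_bracket (x y : {malg K[sv_gen]}) : {malg K[sv_gen]} :=
  lext (fun a => lext (sv_bracket_table lambda mu (fun k => << k >>) a) y) x.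

Lemma sv_bracket_linearl y : linear (fun x => sv_bracket x y).
Proof. exact: lext_linear. Qed.

Lemma sv_bracket_linearr x : linear (sv_bracket x).
Proof.
move=> a y z; rewrite /sv_bracket !(lextE _ x) scaler_sumr -big_split.
apply: eq_bigr => k _ /=.
by rewrite lext_linear scalerDr !scalerA mulrC.
Qed.

Lemma sv_bracketU a b :
  sv_bracket << a >> << b >> =
  sv_bracket_table lambda mu (fun k => << k >>) a b.
Proof. by rewrite /sv_bracket !lextU. Qed.

Lemma sv_bracketxx x : sv_bracket x x = 0.
Proof.
apply: brxx sv_bracket_linearl sv_bracket_linearr sv_bracketU _ x.
exact: malg_linear_ind.
Qed.

Lemma sv_bracket_jacobi x y z :
  sv_bracket x (sv_bracket y z) + sv_bracket y (sv_bracket z x) +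
  sv_bracket z (sv_bracket x y) = 0.
Proof.
apply: br_jacobi sv_bracket_linearl sv_bracket_linearr sv_bracketU _ x y z.
exact: malg_linear_ind.
Qed.

End SchrodingerVirasoro.

Definition schvir (K : numFieldType) (lambda mu : K) : Type :=
  {malg K[sv_gen]}.

HB.instance Definition _ (K : numFieldType) (lambda mu : K) :=
  GRing.Lmodule.on (schvir lambda mu).
HB.instance Definition _ (K : numFieldType) (lambda mu : K) :=
  Lmodule_isLieAlgebra.Build K (schvir lambda mu)
    (sv_bracket_linearl lambda mu) (sv_bracket_linearr lambda mu)
    (sv_bracketxx lambda mu) (sv_bracket_jacobi lambda mu).

Section SchrodingerVirasoroModules.
Variables (K : numFieldType) (lambda mu : K).

Definition svL (m : int) : schvir lambda mu := << GenL m >>.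
Definition svM (m : int) : schvir lambda mu := << GenM m >>.
(* [svY m] is Y_{m - 1/2}. *)
Definition svY (m : int) : schvir lambda mu := << GenY m >>.
Definition svC : schvir lambda mu := << GenC >>.

Definition sv_part (x y z : int) : set (schvir lambda mu) :=
  lspan [set u | exists i : nat,
    [\/ u = svM (x + i%:Z), u = svY (y + i%:Z) | u = svL (z + i%:Z)]].

Definition sv_degree (k : sv_gen) : rat :=
  match k with
  | GenL m | GenM m => m%:~R
  | GenY m => m%:~R - 1 / 2
  | GenC => 0
  end.

Definition sv_homog (r : rat) : set (schvir lambda mu) :=
  [set u : {malg K[sv_gen]} | forall k, k \in msupp u -> sv_degree k = r].

(* [k%:R / 2] ranges over (1/2)Z_+, which does not contain 0. *)
Definition sv_restricted (P : lmodType K) (rho : lieModule (schvir lambda mu) P)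
    : Prop :=
  forall v : P, exists n : nat, forall k : nat, (0 < k)%N ->
  forall u, sv_homog (n%:R + k%:R / 2) u -> rho u v = 0.

End SchrodingerVirasoroModules.

(* Main.v *)
(* Put T = L_t and suppose that the iterates of T on each vector span a
   finite-dimensional space.  If X is one of the families L, M, Y, a given
   vector v and all X_l v with l large lie in a finite-dimensional T-stable
   subspace U, and all L_j with j large map U into a finite-dimensional space.
   Hence a nontrivial combination of the ad(T)^i L_m, i <= d, vanishes on U, and
   so do its images under all ad(T)^q.  Bracketing them with X_l for l = M - qt
   and applying the result to v gives a relation between the vectors
   X_(M+m+it) v whose coefficients are polynomials in q; it holds for many q, so
   comparing top coefficients kills X_n v for all large n.  Thus P is restricted.

   Conversely let v be a nonzero vector of a simple restricted module, killed by
   all elements of degree > n.  Moving the letters of degree > n to the right, a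
   word with at most m letters of degree <= n and total degree > mn kills v.
   The vectors with such a bound form a submodule, so the elements of degree > n
   act locally nilpotently; as only finitely many basis elements of positive
   degree act nontrivially on a given vector, they also act locally finitely. *)

Require Import Defs.
From HB Require Import structures.
From mathcomp Require Import all_boot all_order all_algebra.
From mathcomp Require Import finmap monalg.
From mathcomp Require Import boolp classical_sets reals complex.
From mathcomp Require Import zify ring.

Set Implicit Arguments.
Unset Strict Implicit.
Unset Printing Implicit Defensive.

Import Order.TTheory GRing.Theory Num.Theory.
Local Open Scope ring_scope.
Local Open Scope classical_set_scope.

(** * Finite-dimensional subspaces and stable hulls *)

Section LinearSpan.
Variables (K : fieldType) (V : lmodType K).
Implicit Types (S W : set V) (s : seq V).

Definition subspace W := W 0 /\ forall a u v, W u -> W v -> W (a *: u + v).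

Lemma subspaceZ W a u : subspace W -> W u -> W (a *: u).
Proof. by move=> [W0 Wl] Wu; rewrite -[_ *: _]addr0; exact: Wl. Qed.

Lemma subspaceD W u v : subspace W -> W u -> W v -> W (u + v).
Proof. by move=> [_ Wl] Wu Wv; rewrite -[u]scale1r; exact: Wl. Qed.

Lemma subspaceB W u v : subspace W -> W u -> W v -> W (u - v).
Proof. by move=> [_ Wl] Wu Wv; rewrite addrC -scaleN1r; exact: Wl. Qed.

Lemma subspace_sum W (I : Type) (r : seq I) (Q : pred I) (F : I -> V) :
  subspace W -> (forall i, Q i -> W (F i)) -> W (\sum_(i <- r | Q i) F i).
Proof.
by move=> sW WF; elim/big_ind: _ => //; [case: sW|move=> *; exact: subspaceD].
Qed.

Lemma lspan_subspace S : subspace (lspan S).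
Proof.
split.
  by exists 0, (fun=> 0), (fun=> 0); split=> [[]|] //; rewrite big_ord0.
move=> a u v [m [b [e [eS ->]]]] [n [c [f [fS ->]]]].
pose bc i := match split i with inl j => a * b j | inr j => c j end.
pose ef i := match split i with inl j => e j | inr j => f j end.
exists (m + n)%N, bc, ef; split=> [i|]; first by rewrite /ef; case: split.
rewrite big_split_ord scaler_sumr /bc /ef; congr (_ + _).
  by apply: eq_bigr => i _; rewrite (unsplitK (inl _)) scalerA.
by apply: eq_bigr => i _; rewrite (unsplitK (inr _)).
Qed.

Lemma sub_lspan S u : S u -> lspan S u.
Proof.
by move=> Su; exists 1%N, (fun=> 1), (fun=> u); rewrite big_ord1 scale1r.
Qed.

Lemma lspan_min S W : subspace W -> S `<=` W -> lspan S `<=` W.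
Proof.
move=> sW SW _ [n [a [e [eS ->]]]]; apply: subspace_sum => // i _.
by apply: subspaceZ => //; exact/SW.
Qed.

Lemma lspan_sub S S' : S `<=` lspan S' -> lspan S `<=` lspan S'.
Proof. exact: lspan_min (lspan_subspace S'). Qed.

Lemma lspan_mem s u : u \in s -> lspan [set` s] u.
Proof. by move=> us; exact: sub_lspan. Qed.

Lemma lspan_subseq s s' :
  {subset s <= s'} -> lspan [set` s] `<=` lspan [set` s'].
Proof. by move=> ss'; apply: lspan_sub => u /ss' /lspan_mem. Qed.

Lemma lspan_catl s s' u : lspan [set` s] u -> lspan [set` s ++ s'] u.
Proof. by apply: lspan_subseq => x; rewrite mem_cat => ->. Qed.

Lemma lspan_catr s s' u : lspan [set` s'] u -> lspan [set` s ++ s'] u.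
Proof. by apply: lspan_subseq => x; rewrite mem_cat orbC => ->. Qed.

Lemma lspan_cons x s u :
  lspan [set` x :: s] u -> exists a, lspan [set` s] (u - a *: x).
Proof.
move: u; apply: lspan_min => [|u].
  split=> [|a u v [b bP] [c cP]].
    by exists 0; rewrite scale0r subr0; case: (lspan_subspace [set` s]).
  exists (a * b + c).
  have -> : a *: u + v - (a * b + c) *: x = a *: (u - b *: x) + (v - c *: x).
    by rewrite scalerBr scalerDl scalerA opprD addrACA.
  by case: (lspan_subspace [set` s]) => _; exact.
rewrite /= inE => /orP[/eqP ->|us].
  by exists 1; rewrite scale1r subrr; case: (lspan_subspace [set` s]).
by exists 0; rewrite scale0r subr0; exact: lspan_mem.
Qed.

Lemma lspan_coords s u :
  lspan [set` s] u -> exists c : 'I_(size s) -> K, u = \sum_i c i *: s`_i.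
Proof.
elim: s u => [|x s IHs] u.
  move=> su; exists (fun=> 0); rewrite big_ord0.
  apply: (@lspan_min _ [set 0]) su => [|y] //.
  by split=> // a y z /= -> ->; rewrite scaler0 addr0.
move=> /lspan_cons[a /IHs[c uE]].
exists (fun i => if unlift ord0 i is Some j then c j else a).
rewrite big_ord_recl /= unlift_none; under eq_bigr do rewrite liftK /=.
by rewrite -uE addrC subrK.
Qed.

(** [fin_dim] demands a list spanning [W] exactly, so one is built by induction on [s]: the
    intersection of [W] with the span of the tail has one, and at most one further vector, with
    nonzero coefficient on the head [x], is needed. *)
Lemma subspace_fin_dim W s : subspace W -> W `<=` lspan [set` s] -> fin_dim W.
Proof.
elim: s W => [|x s IHs] W sW Ws.
  exists [::]; apply/seteqP; split=> //; exact: lspan_min.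
pose W' := W `&` lspan [set` s].
have sW' : subspace W'.
  have [s0 sl] := lspan_subspace [set` s]; case: (sW) => W0 Wl.
  by split=> // a u v [Wu su] [Wv sv]; split; [exact: Wl|exact: sl].
have [l W'E] : fin_dim W' by apply: IHs => // u [].
have lW : lspan [set` l] `<=` W by rewrite -W'E => u [].
have [[w [a [Ww a0 wx]]]|nw] :=
    pselect (exists w a, [/\ W w, a != 0 & lspan [set` s] (w - a *: x)]).
  exists (w :: l); apply/seteqP; split=> [u Wu|]; last first.
    apply: lspan_min => // u; rewrite /= inE => /orP[/eqP -> //|ul].
    by apply: lW; exact: lspan_mem.
  have [b ux] := lspan_cons (Ws _ Wu).
  rewrite -[u](subrK ((b / a) *: w)); apply: subspaceD.
  - exact: lspan_subspace.
  - apply: (@lspan_subseq l) => [y|]; first by rewrite inE orbC => ->.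
    rewrite -W'E; split; first by apply: subspaceB => //; exact: subspaceZ.
    have -> : u - (b / a) *: w =
        (u - b *: x) - (b / a) *: (w - a *: x).
      by rewrite scalerBr scalerA divfK // opprB addrA subrK.
    by apply: subspaceB; [exact: lspan_subspace| |apply: subspaceZ;
      [exact: lspan_subspace|]].
  - apply: subspaceZ; first exact: lspan_subspace.
    by apply: lspan_mem; rewrite mem_head.
exists l; apply/seteqP; split=> // u Wu; rewrite -W'E; split=> //.
have [b ux] := lspan_cons (Ws _ Wu).
have [b0|bn0] := eqVneq b 0; first by rewrite b0 scale0r subr0 in ux.
by case: nw; exists u, b.
Qed.

(** In coordinates each map becomes a [size e] by [size f] matrix, and one more matrix than the
    product of the sizes is linearly dependent. The relation is stored as a polynomial so that its
    leading coefficient marks the last map that occurs. *)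
Lemma dependent_maps (x : nat -> V -> V) (e f : seq V) :
  (forall i u, u \in e -> lspan [set` f] (x i u)) ->
  exists2 p : {poly K}, p != 0 &
    forall u, u \in e -> \sum_(i < size p) p`_i *: x i u = 0.
Proof.
move=> xf; pose a := size e; pose b := size f.
have /choice[c cE] (ij : nat * 'I_a) : exists c : 'I_b -> K,
    x ij.1 e`_ij.2 = \sum_k c k *: f`_k.
  by apply: lspan_coords; apply: xf; exact: mem_nth.
pose A (i : nat) : 'M[K]_(a, b) := \matrix_(j, k) c (i, j) k.
pose M : 'M[K]_((a * b).+1, a * b) := \matrix_(i < (a * b).+1) mxvec (A i).
have kM : kermx M != 0.
  rewrite kermx_eq0 /row_free; apply: contraTneq (rank_leq_col M) => ->.
  by rewrite -ltnNge.
have /rowV0Pn[r /sub_kermxP rM r0] := kM.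
pose p := \poly_(i < (a * b).+1) r 0 (inord i).
have pE (i : 'I_(a * b).+1) : p`_i = r 0 i.
  by rewrite coef_poly ltn_ord inord_val.
exists p.
  apply: contra_neq r0 => p0; apply/rowP => i; rewrite -pE p0 coef0 mxE //.
have sp : (size p <= (a * b).+1)%N by exact: size_poly.
move=> u ue.
have -> : \sum_(i < size p) p`_i *: x i u =
    \sum_(i < (a * b).+1) p`_i *: x i u.
  rewrite (big_ord_widen _ (fun i => p`_i *: x i u) sp) big_mkcond /=.
  apply: eq_bigr => i _; case: ltnP => // spi.
  by rewrite nth_default // scale0r.
have iu : (index u e < a)%N by rewrite index_mem.
pose j := Ordinal iu.
have uE i : x i u = \sum_k A i j k *: f`_k.
  rewrite -{1}(nth_index 0 ue) (cE (i, j)).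
  by apply: eq_bigr => k _; rewrite mxE.
under eq_bigr => i _ do rewrite uE pE scaler_sumr.
rewrite exchange_big big1 //= => k _.
under eq_bigr do rewrite scalerA.
rewrite -scaler_suml.
have /rowP/(_ (mxvec_index j k)) := rM.
rewrite [LHS]mxE [RHS]mxE => rM0.
rewrite -[RHS](scale0r f`_k); congr (_ *: _); rewrite -[RHS]rM0.
by apply: eq_bigr => i _; rewrite [in RHS]mxE mxvecE.
Qed.

End LinearSpan.

Section LinearMaps.
Variables (K : fieldType) (U V : lmodType K) (f : U -> V).
Hypothesis f_linear : linear f.

Let F : {linear U -> V} :=
  HB.pack f (GRing.isLinear.Build K U V *:%R f f_linear).

Lemma lin0 : f 0 = 0.
Proof. exact: (raddf0 F). Qed.

Lemma linD u v : f (u + v) = f u + f v.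
Proof. exact: (raddfD F). Qed.

Lemma linZ a u : f (a *: u) = a *: f u.
Proof. exact: (linearZ_LR F). Qed.

Lemma lin_sum (I : Type) (r : seq I) (Q : pred I) (E : I -> U) :
  f (\sum_(i <- r | Q i) E i) = \sum_(i <- r | Q i) f (E i).
Proof. exact: (raddf_sum F). Qed.

Lemma preimage_subspace (W : set V) : subspace W -> subspace (f @^-1` W).
Proof.
move=> [W0 Wl]; split=> [|a u v Wu Wv]; rewrite /preimage /= ?lin0 //.
by rewrite f_linear; exact: Wl.
Qed.

End LinearMaps.

Section StableHull.
Variables (K : fieldType) (V : lmodType K) (T : V -> V).
Hypothesis T_linear : linear T.

(** The consequence shared by local finiteness of [L_t] and of a part containing [L_t]: the list
    need only contain the iterates in its span. *)
Definition bounded_iterates :=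
  forall v, exists s : seq V,
    forall n, (0 < n)%N -> lspan [set` s] (iter n T v).

Definition stable (s : seq V) :=
  forall u, lspan [set` s] u -> lspan [set` s] (T u).

Lemma stable_gen (s : seq V) :
  (forall u, u \in s -> lspan [set` s] (T u)) -> stable s.
Proof.
move=> sT; apply: lspan_min => //; apply: preimage_subspace => //.
exact: lspan_subspace.
Qed.

Lemma stable_cat s s' : stable s -> stable s' -> stable (s ++ s').
Proof.
move=> sT s'T; apply: stable_gen => u; rewrite mem_cat => /orP[us|us'].
  by apply/lspan_catl/sT/lspan_mem.
by apply/lspan_catr/s'T/lspan_mem.
Qed.

Hypothesis Tb : bounded_iterates.

Lemma stable_hull1 v : exists2 s : seq V, v \in s & stable s.
Proof.
have [f fT] := Tb v.
(* Exponents start at 1, where [bounded_iterates] applies. The relation expresses [T^(d+1) v]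
   through lower iterates, so [v, ..., T^d v] span a stable space. *)
have [i u|p p0 pT] := @dependent_maps _ _ (fun i => iter i.+1 T) [:: v] f.
  by rewrite inE => /eqP ->; exact: fT.
have {}pT := pT v (mem_head _ _).
have sp : (0 < size p)%N by rewrite size_poly_gt0.
pose d := (size p).-1; have spE : size p = d.+1 by rewrite prednK.
pose s := [seq iter i T v | i <- iota 0 d.+1].
have ms i : (i <= d)%N -> iter i T v \in s.
  by move=> id; apply/mapP; exists i => //; rewrite mem_iota.
exists s; first exact: (ms 0%N).
apply: stable_gen => u /mapP[j]; rewrite mem_iota => jd ->.
move: jd; rewrite leq0n add0n ltnS leq_eqVlt /= => /orP[/eqP ->|jd]; last first.
  exact/lspan_mem/(ms j.+1).
have pd0 : p`_d != 0 by rewrite -lead_coefE lead_coef_eq0.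
move: pT; rewrite spE big_ord_recr /= => /eqP; rewrite addr_eq0 => /eqP pT.
have ss := lspan_subspace [set` s].
rewrite -[T _]scale1r -(mulVf pd0) -scalerA -[_ *: T _]opprK -pT -scaleN1r.
do 2 apply: subspaceZ => //; apply: subspace_sum => // i _.
by apply: subspaceZ => //; exact/lspan_mem/(ms i.+1).
Qed.

Lemma stable_hull (s : seq V) :
  exists2 s' : seq V, {subset s <= s'} & stable s'.
Proof.
elim: s => [|v s [s' ss' s'T]].
  by exists [::] => //; apply: stable_gen.
have [h vh hT] := stable_hull1 v.
exists (h ++ s'); last exact: stable_cat.
move=> u; rewrite inE mem_cat => /orP[/eqP ->|/ss' ->]; rewrite ?vh //.
by rewrite orbT.
Qed.

End StableHull.

(** * Vector-valued polynomials *)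

Section Polynomials.
Variables (K : numFieldType) (V : lmodType K).

(** A polynomial of degree at most [d] is determined by its values at [0, ..., d]. The last column
    of the inverse Vandermonde matrix gives weights [w] that extract the coefficient of degree [d]
    from these values. *)
Lemma lead_sum0 n (G : 'I_n -> {poly K}) (u : 'I_n -> V) d :
  (forall i, (size (G i) <= d.+1)%N) ->
  (forall q, (q <= d)%N -> \sum_i (G i).[q%:R] *: u i = 0) ->
  \sum_i (G i)`_d *: u i = 0.
Proof.
move=> sG G0; pose a : 'rV[K]_d.+1 := \row_q (q : nat)%:R.
pose A := Vandermonde d.+1 a.
have uA : A \in unitmx.
  rewrite unitmxE det_Vandermonde unitfE; apply/prodf_neq0 => i _.
  apply/prodf_neq0 => j ij; rewrite !mxE subr_eq0 eqr_nat.
  by rewrite gtn_eqF.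
pose w (q : 'I_d.+1) := invmx A q ord_max.
have wE (k : 'I_d.+1) :
    \sum_(q < d.+1) (q : nat)%:R ^+ k * w q = (k == ord_max)%:R.
  have /matrixP/(_ k ord_max) := mulmxV uA; rewrite !mxE => <-.
  by apply: eq_bigr => q _; rewrite !mxE.
have GE i : (G i)`_d = \sum_(q < d.+1) w q * (G i).[(q : nat)%:R].
  under eq_bigr => q _ do rewrite (horner_coef_wide _ (sG i)) mulr_sumr.
  rewrite exchange_big /=.
  have colE (k : 'I_d.+1) :
      \sum_(q < d.+1) w q * ((G i)`_k * (q : nat)%:R ^+ k) =
      (G i)`_k * (k == ord_max)%:R.
    by rewrite -wE mulr_sumr; apply: eq_bigr => q _; ring.
  under eq_bigr do rewrite colE.
  by rewrite big_ord_recr /= eqxx mulr1 big1 ?add0r // => k _;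
    rewrite -val_eqE /= ltn_eqF ?mulr0.
under eq_bigr => i _ do rewrite GE scaler_suml.
rewrite exchange_big big1 //= => q _.
under eq_bigr do rewrite -scalerA.
by rewrite -scaler_sumr G0 ?scaler0 // -ltnS.
Qed.

Lemma coef_mul_affine (p : {poly K}) (a b : K) n :
  (size p <= n.+1)%N -> (p * (a *: 'X + b%:P))`_n.+1 = a * p`_n.
Proof.
move=> sp; rewrite mulrDr -scalerAr coefD coefZ coefMX coefMC.
by rewrite (nth_default _ sp) mul0r addr0.
Qed.

Lemma size_mul_affine (p : {poly K}) (a b : K) n :
  (size p <= n)%N -> (size (p * (a *: 'X + b%:P))%R <= n.+1)%N.
Proof.
move=> sp; apply: leq_trans (size_polyMleq _ _) _.
have : (size (a *: 'X + b%:P)%R <= 2)%N.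
  rewrite (leq_trans (size_polyD _ _)) // geq_max.
  rewrite (leq_trans (size_scale_leq _ _)) ?size_polyX //=.
  by rewrite (leq_trans (size_polyC_leq1 _)).
by move: sp; lia.
Qed.

(* ad (L_t)^i L_j = (rising_poly m t i).[q] L_(j+it) for j = m + qt. *)
Fixpoint rising_poly (m t i : nat) : {poly K} :=
  if i is k.+1 then
    rising_poly m t k * (t%:R *: 'X + (m%:R + k%:R * t%:R - t%:R)%:P)
  else 1.

Lemma size_rising_poly m t i : (size (rising_poly m t i) <= i.+1)%N.
Proof.
by elim: i => [|i IHi]; [rewrite size_poly1|exact: size_mul_affine].
Qed.

Lemma coef_rising_poly m t i : (rising_poly m t i)`_i = t%:R ^+ i.
Proof.
elim: i => [|i IHi]; first by rewrite coef1.
by rewrite coef_mul_affine ?size_rising_poly // IHi exprS.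
Qed.

(** The first [q] applications of [ad(L_t)] lead from [L_m] to a multiple of [L_(m+qt)], and the
    other [i] start there. The first factor is common to all [i] and is cancelled later. *)
Lemma rising_polyD m t i q :
  (rising_poly m t (i + q)).[0] =
  (rising_poly m t q).[0] * (rising_poly m t i).[q%:R].
Proof.
elim: i => [|i IHi]; first by rewrite hornerC mulr1.
rewrite addSn /= !hornerM IHi -mulrA; congr (_ * (_ * _)).
by rewrite !hornerD !hornerZ !hornerX !hornerC natrD; ring.
Qed.

Lemma rising_poly_neq0 m t i : (t < m)%N -> (rising_poly m t i).[0] != 0.
Proof.
move=> tm; elim: i => [|i IHi]; first by rewrite hornerC oner_neq0.
rewrite hornerM mulf_neq0 // hornerD hornerZ hornerX hornerC mulr0 add0r.
rewrite addrAC -natrB 1?ltnW // -natrM -natrD.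
by rewrite pnatr_eq0; lia.
Qed.

Lemma eventually_neq (z : K) :
  exists n0 : nat, forall n, (n0 <= n)%N -> n%:R != z.
Proof.
have [[k <-]|nz] := pselect (exists k : nat, k%:R = z).
  by exists k.+1 => n kn; rewrite eqr_nat gtn_eqF.
by exists 0%N => n _; apply: contra_notN nz => /eqP; exists n.
Qed.

End Polynomials.

(** * Local finiteness of L_t kills the tails *)

Section WittFamilies.
Variables (K : numFieldType) (g : lieAlgType K) (P : lmodType K).
Variables (rho : lieModule g P) (L : nat -> g).

(** Treats [L], [M] and [Y] uniformly. With [m] positive and natural indices the central term of
    [[L_m, L_n]] never appears. *)
Definition witt_family (alpha beta : K) (X : nat -> g) :=
  forall m n, (0 < m)%N ->
    lie (L m) (X n) = (n%:R - alpha * m%:R + beta) *: X (m + n)%N.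

Lemma act_lie_comm x y v : rho x (rho y v) = rho (lie x y) v + rho y (rho x v).
Proof. by rewrite lie_act_bracket subrK. Qed.

Variable t : nat.
Hypotheses (t_gt0 : (0 < t)%N) (Lt_bounded : bounded_iterates (rho (L t))).

(** Since [X_(t+j)] is a nonzero multiple of [[L_t, X_j]], the [t] operators [X_m, ..., X_(m+t-1)]
    control all later ones: [X_(t+j) u] is a combination of [L_t X_j u] and [X_j L_t u]. The
    induction keeps [u] general because it is also used at [L_t u]. *)
Lemma family_hull alpha beta X m (s : seq P) :
  witt_family alpha beta X ->
  (forall n, (m <= n)%N -> n%:R - alpha * t%:R + beta != 0) ->
  stable (rho (L t)) s ->
  exists2 s' : seq P, stable (rho (L t)) s' &
    forall n u, (m <= n)%N -> lspan [set` s] u -> lspan [set` s'] (rho (X n) u).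
Proof.
move=> wX X0 sT.
pose l := [seq rho (X (m + r)%N) u | r <- iota 0 t, u <- s].
have [s' ls' s'T] := stable_hull (lie_act_linearr rho (L t)) Lt_bounded l.
exists s' => // n; have [k] := ubnP n; elim: k n => // k IHk n nk u mn.
have [nt|tn] := ltnP n (m + t).
  move: u; apply: lspan_min.
    by apply: preimage_subspace (lspan_subspace _); exact: lie_act_linearr.
  move=> u us; apply/lspan_mem/ls'/allpairsP; exists ((n - m)%N, u) => /=.
  by rewrite mem_iota subnKC //; split=> //; lia.
have [j nE] : exists j, n = (t + j)%N by exists (n - t)%N; lia.
have mj : (m <= j)%N by lia.
have jk : (j < k)%N by lia.
rewrite nE => us; have ss := lspan_subspace [set` s'].
rewrite -[X _]scale1r -(mulVf (X0 j mj)) -scalerA -wX //.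
rewrite (linZ (lie_act_linearl rho _)); apply: subspaceZ => //.
rewrite lie_act_bracket; apply: subspaceB => //.
  by apply: s'T; exact: IHk.
by apply: IHk => //; exact: sT.
Qed.

Hypothesis wL : witt_family 1 0 L.

(** On the stable span of [s] the operators [ad(L_t)^i L_m] have values in one finite-dimensional
    space, hence satisfy a relation. Commuting it with [L_t] keeps it valid there and replaces [i]
    by [i + 1], which yields every [q]. *)
Lemma annihilating_shifts m (s : seq P) :
  (t < m)%N -> stable (rho (L t)) s ->
  exists2 p : {poly K}, p != 0 & forall q u, lspan [set` s] u ->
    \sum_(i < size p) p`_i *:
      ((rising_poly K m t (i + q)).[0] *: rho (L (m + (i + q) * t)%N) u) = 0.
Proof.
move=> tm sT.
have L0 n : (m <= n)%N -> n%:R - 1 * t%:R + 0 != 0 :> K.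
  by move=> mn; rewrite addr0 mul1r subr_eq0 eqr_nat; lia.
have [f _ fP] := family_hull wL L0 sT.
pose x i u := (rising_poly K m t i).[0] *: rho (L (m + i * t)%N) u.
have [i u us|p p0 px] := @dependent_maps _ _ x s f.
  apply: subspaceZ; first exact: lspan_subspace.
  by apply: fP; [lia|exact: lspan_mem].
exists p => //.
have xT i u : x i.+1 u = rho (L t) (x i u) - x i (rho (L t) u).
  rewrite /x (linZ (lie_act_linearr rho _)) -scalerBr -lie_act_bracket wL //.
  rewrite (linZ (lie_act_linearl rho _)) scalerA /= hornerM.
  rewrite hornerD hornerZ hornerX hornerC mulr0 add0r.
  have -> : (t + (m + i * t) = m + i.+1 * t)%N by rewrite mulSn; lia.
  by congr (_ * _ *: _); rewrite natrD natrM; ring.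
have x_linear i : linear (x i).
  by move=> a u v; rewrite /x lie_act_linearr scalerDr !scalerA mulrC.
elim=> [|q IHq] u us.
  (* [dependent_maps] gives the relation on the entries of [s] only; linearity extends it to the
     span. *)
  move: u us; apply: (@lspan_min _ _ _ [set u | _ = 0]) => [|u us] /=; last first.
    by rewrite -[RHS](px u us); apply: eq_bigr => i _; rewrite addn0.
  split=> [|a u v uE vE] /=.
    by rewrite big1 // => i _; rewrite -/(x _ 0) (lin0 (x_linear _)) scaler0.
  rewrite -[LHS]/(\sum_(i < size p) p`_i *: x (i + 0)%N (a *: u + v)).
  transitivity (a *: (\sum_(i < size p) p`_i *: x (i + 0)%N u) +
                \sum_(i < size p) p`_i *: x (i + 0)%N v); last first.
    by rewrite [X in a *: X]uE [X in _ + X]vE scaler0 addr0.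
  rewrite scaler_sumr -big_split /=.
  apply: eq_bigr => i _ /=.
  rewrite x_linear scalerDr; congr (_ + _); move: (x _ u) => y.
  by rewrite !scalerA mulrC.
under eq_bigr => i _ do rewrite addnS -/(x _ u) xT scalerBr.
rewrite sumrB [X in _ - X](IHq (rho (L t) u)) ?subr0; last exact: sT.
have := congr1 (rho (L t)) (IHq u us).
rewrite (lin0 (lie_act_linearr rho _)) (lin_sum (lie_act_linearr rho _)) => rE.
rewrite -[RHS]rE; apply: eq_bigr => i _.
by rewrite [RHS](linZ (lie_act_linearr rho _)).
Qed.

Lemma witt_family_eventually0 alpha beta X v :
  witt_family alpha beta X ->
  exists N, forall n, (N <= n)%N -> rho (X n) v = 0.
Proof.
move=> wX.
(* Beyond [m0] the structure constant of [[L_t, X_n]] is nonzero; [t < m] keeps the rising products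
   nonzero. *)
have [m0 m0P] := eventually_neq (alpha * t%:R - beta).
pose m := maxn m0 t.+1; have tm : (t < m)%N by rewrite leq_max ltnSn orbT.
have X0 n : (m <= n)%N -> n%:R - alpha * t%:R + beta != 0.
  move=> mn; have := m0P n; rewrite -subr_eq0 opprB addrA addrAC; apply.
  by apply: leq_trans mn; rewrite leq_maxl.
have [s0 vs0 s0T] := stable_hull1 (lie_act_linearr rho (L t)) Lt_bounded v.
have [sX sXT sXP] := family_hull wX X0 s0T.
have sT := stable_cat (lie_act_linearr rho (L t)) s0T sXT.
have [p p0 pP] := annihilating_shifts tm sT.
have sp : size p = (size p).-1.+1 by rewrite prednK // size_poly_gt0.
set d := (size p).-1 in sp.
have pd0 : p`_d != 0 by rewrite -lead_coefE lead_coef_eq0.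
have vs : lspan [set` s0] v by exact: lspan_mem.
pose c i := rising_poly K m t i.
(* Both [v] and [X_l v] lie in the span of [s0 ++ sX]. Subtracting [X_l] applied to the relation at
   [v] from the relation at [X_l v] leaves the relation for the commutators. *)
have brE q l : (m <= l)%N ->
    \sum_(i < size p) p`_i *: ((c (i + q)%N).[0] *:
      ((l%:R - alpha * (m + (i + q) * t)%:R + beta) *:
        rho (X (m + (i + q) * t + l)%N) v)) = 0.
  move=> ml.
  have := congr1 (rho (X l)) (pP q v (lspan_catl _ vs)).
  rewrite (lin0 (lie_act_linearr rho _)) (lin_sum (lie_act_linearr rho _)) => vE.
  have XlE := pP q _ (lspan_catr s0 (sXP l v ml vs)).
  rewrite -[RHS](subr0 (0 : P)) -[X in _ = X - _]XlE -[X in _ = _ - X]vE.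
  rewrite -sumrB; apply: eq_bigr => i _.
  rewrite !(linZ (lie_act_linearr rho _)) -!scalerBr -lie_act_bracket wX.
    by rewrite (linZ (lie_act_linearl rho _)).
  by rewrite addn_gt0 (leq_trans _ tm).
(* The coefficient of [X_(M+m+it) v] for [l = M - qt], as a polynomial in [q], after removal of the
   common factor [(c q).[0]]. *)
pose G M i : {poly K} := p`_i *: (c i * ((- (1 + alpha) * t%:R) *: 'X +
  (M%:R - alpha * (m + i * t)%:R + beta)%:P)).
have GE M q : (m + q * t <= M)%N ->
    \sum_(i < size p) (G M i).[q%:R] *: rho (X (M + m + i * t)%N) v = 0.
  move=> qM; have cq := rising_poly_neq0 K q tm.
  have ml : (m <= M - q * t)%N by lia.
  apply: (scalerI cq); rewrite scaler0 -[RHS](brE q _ ml) scaler_sumr.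
  apply: eq_bigr => i _.
  have -> : (m + (i + q) * t + (M - q * t) = M + m + i * t)%N by lia.
  rewrite !scalerA /c rising_polyD; congr (_ *: _).
  rewrite /G hornerZ hornerM hornerD hornerZ hornerX hornerC.
  by rewrite natrB ?natrD ?natrM; [ring|lia].
have sG M i : (size (G M i) <= i.+2)%N.
  rewrite (leq_trans (size_scale_leq _ _)) //.
  by rewrite size_mul_affine // size_rising_poly.
have cG M i : (G M i)`_i.+1 = p`_i * (- (1 + alpha) * t%:R * t%:R ^+ i).
  by rewrite coefZ coef_mul_affine ?size_rising_poly // coef_rising_poly.
(* In degree [D] only the term [i = d] survives. The bound on [M] makes the relation available at
   the sample points [q = 0, ..., D]. *)
have Gvanish M D : (m + D * t <= M)%N -> (G M d)`_D != 0 ->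
    (forall i, (i < d)%N -> (G M i)`_D = 0) ->
    (forall i, (i <= d)%N -> (size (G M i) <= D.+1)%N) ->
    rho (X (M + m + d * t)%N) v = 0.
  move=> DM Gd0 Gi0 sGD.
  have : \sum_(i < size p) (G M i)`_D *: rho (X (M + m + i * t)%N) v = 0.
    apply: (@lead_sum0 _ _ _ (fun i => G M i)
      (fun i => rho (X (M + m + i * t)%N) v)) => [i|q qD].
      by apply: sGD; rewrite -ltnS -sp.
    by apply: GE; apply: leq_trans DM; rewrite leq_add2l leq_mul2r qD orbT.
  rewrite sp big_ord_recr /= big1 ?add0r => [/eqP|i _].
    by rewrite scaler_eq0 (negbTE Gd0) => /eqP.
  by rewrite Gi0 ?scale0r.
have t0 : t%:R != 0 :> K by rewrite pnatr_eq0 -lt0n.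
(* If alpha = -1 the coefficient of X_(M+m+it) v has degree i in q, not i + 1. *)
have [a1|a1] := eqVneq (1 + alpha) 0; last first.
  exists (m + d.+1 * t + m + d * t)%N => n nN.
  have -> : n = (n - m - d * t + m + d * t)%N by lia.
  apply: (@Gvanish _ d.+1) => [||i id|i id].
  - by lia.
  - by rewrite cG !mulf_neq0 ?oppr_eq0 ?expf_neq0.
  - by rewrite nth_default // (leq_trans (sG _ _)).
  - exact: leq_trans (sG _ _) _.
have aE : alpha = -1 by apply/eqP; rewrite -addr_eq0 addrC a1.
(* Here the top coefficient contains the factor [n + beta], with [n = M + m + d * t]; it is nonzero
   once [n] is at least [k]. *)
have [k kP] := eventually_neq (- beta : K).
exists (m + d * t + m + d * t + k)%N => n nN.
have -> : n = (n - m - d * t + m + d * t)%N by lia.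
set M := (n - m - d * t)%N.
have Gconst i : G M i = (p`_i * ((M + m + i * t)%:R + beta)) *: c i.
  rewrite /G a1 oppr0 mul0r scale0r add0r mulrC mul_polyC scalerA.
  by rewrite aE !natrD; congr (_ *: _); ring.
apply: (@Gvanish _ d) => [||i id|i id].
- by rewrite /M; lia.
- rewrite Gconst coefZ coef_rising_poly !mulf_neq0 ?expf_neq0 //.
  rewrite -[beta]opprK subr_eq0 kP //; rewrite /M; lia.
- rewrite Gconst coefZ [(c i)`_d]nth_default ?mulr0 //.
  by rewrite (leq_trans (size_rising_poly _ _ _ _)).
- rewrite Gconst (leq_trans (size_scale_leq _ _)) //.
  by rewrite (leq_trans (size_rising_poly _ _ _ _)).
Qed.

End WittFamilies.

(** * Restricted modules and the degree filtration *)

Section Filtration.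
Variables (K : numFieldType) (lambda mu : K).
Local Notation g := (schvir lambda mu).

Definition sv_basis (k : sv_gen) : g := << k >>.

(* Twice [sv_degree]. *)
Definition sv_deg2 (k : sv_gen) : int :=
  match k with
  | GenL m | GenM m => 2 * m
  | GenY m => 2 * m - 1
  | GenC => 0
  end.

Lemma sv_degreeE k : sv_degree k = (sv_deg2 k)%:~R / 2.
Proof.
by case: k => [m|m|m|] /=; rewrite ?intrD ?intrM ?intrN ?mul0r //; field.
Qed.

(** Doubled degrees keep the index an integer. [C] belongs to the layers with [d <= 0]. *)
Definition sv_filt (d : int) : set g :=
  lspan [set sv_basis k | k in [set k | d <= sv_deg2 k]].

Lemma sv_filt_subspace d : subspace (sv_filt d).
Proof. exact: lspan_subspace. Qed.

Lemma sv_filt_basis d k : d <= sv_deg2 k -> sv_filt d (sv_basis k).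
Proof. by move=> dk; apply: sub_lspan; exists k. Qed.

Lemma sv_filt_ind d (W : set g) : subspace W ->
  (forall k, d <= sv_deg2 k -> W (sv_basis k)) -> sv_filt d `<=` W.
Proof. by move=> sW Wk; apply: lspan_min => // _ [k dk <-]; exact: Wk. Qed.

Lemma sv_filt_le d d' : d' <= d -> sv_filt d `<=` sv_filt d'.
Proof.
move=> dd'; apply: sv_filt_ind; first exact: sv_filt_subspace.
by move=> k dk; apply: sv_filt_basis; exact: le_trans dk.
Qed.

Lemma sv_filt_exhaustive (x : g) : exists d, sv_filt d x.
Proof.
elim/malg_linear_ind: x => [|a x y [d dx] [d' dy]|k].
- by exists 0; case: (sv_filt_subspace 0).
- exists (Order.min d d'); apply: (sv_filt_subspace _).2.
    by apply: sv_filt_le dx; rewrite ge_min lexx.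
  by apply: sv_filt_le dy; rewrite ge_min lexx orbT.
- by exists (sv_deg2 k); exact: sv_filt_basis.
Qed.

Lemma lie_basis a b :
  lie (sv_basis a) (sv_basis b) = sv_bracket_table lambda mu sv_basis a b.
Proof. exact: sv_bracketU. Qed.

Lemma sv_filt_lie d d' x y :
  sv_filt d x -> sv_filt d' y -> sv_filt (d + d') (lie x y).
Proof.
move=> dx dy; have sF := sv_filt_subspace (d + d').
have lt a u : sv_deg2 u >= d + d' -> sv_filt (d + d') (a *: sv_basis u).
  by move=> du; apply: subspaceZ => //; exact: sv_filt_basis.
move: x dx; apply: (@sv_filt_ind d ((fun x => lie x y) @^-1` sv_filt (d + d'))).
  by apply: preimage_subspace => //; exact: lie_linearl.
move=> a da; move: y dy.
apply: (@sv_filt_ind d' (lie (sv_basis a) @^-1` sv_filt (d + d'))).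
  by apply: preimage_subspace => //; exact: lie_linearr.
move=> b db; rewrite /preimage /= lie_basis; case: sF => F0 Fl.
case: a b da db => [m|m|m|] [n|n|n|] //= dm dn; rewrite -?scaleNr;
  try (by apply: lt => /=; lia).
apply: Fl; first by apply: sv_filt_basis => /=; lia.
(* The central term survives only for [m + n = 0], and then [d + d' <= 0], which admits [C]. *)
case: eqP => [mn|_]; last by rewrite scale0r.
by apply: lt => /=; lia.
Qed.

Lemma sv_part_filt (d : int) x y z :
  d <= 2 * x -> d <= 2 * y - 1 -> d <= 2 * z ->
  sv_part x y z `<=` sv_filt d.
Proof.
move=> dx dy dz; apply: lspan_min; first exact: sv_filt_subspace.
by move=> _ [i [] ->]; apply: sv_filt_basis => /=; lia.
Qed.

End Filtration.

(** * Words acting on restricted modules *)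

Section Restricted.
Variables (K : numFieldType) (lambda mu : K) (P : lmodType K).
Local Notation g := (schvir lambda mu).
Variable rho : lieModule g P.

Lemma restricted_filt v : sv_restricted rho ->
  exists n : nat, forall x, sv_filt (n%:Z + 1) x -> rho x v = 0.
Proof.
move=> /(_ v)[n nP]; exists (2 * n)%N.
apply: (@sv_filt_ind _ _ _ _ ((fun x => rho x v) @^-1` [set 0])).
  apply: preimage_subspace; first exact: lie_act_linearl.
  by split=> // a u w /= -> ->; rewrite scaler0 addr0.
move=> k kn; pose j := absz (sv_deg2 k - (2 * n)%N%:Z).
have kE : sv_deg2 k = 2 * n%:Z + j%:Z by rewrite /j; lia.
apply: (nP j) => [|l]; first by rewrite /j; lia.
rewrite /sv_basis msuppU oner_eq0 inE => /eqP ->.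
by rewrite sv_degreeE kE intrD intrM; field.
Qed.

(** A letter carries a declared lower bound for its doubled degree, certified by [word_filt].
    Letters need not be homogeneous, and the bounds add under commutators. *)
Definition sv_word (w : seq (int * g)) v := foldr (fun x u => rho x.2 u) v w.

Definition sv_weight (w : seq (int * g)) : int := \sum_(x <- w) x.1.

Definition word_filt (w : seq (int * g)) :=
  forall x, x \in w -> sv_filt x.1 x.2.

Lemma word_filt_cons x w :
  word_filt (x :: w) <-> sv_filt x.1 x.2 /\ word_filt w.
Proof.
split=> [xwF|[xF wF] y]; last by rewrite inE => /orP[/eqP ->|/wF].
split=> [|y yw]; first by apply: xwF; exact: mem_head.
by apply: xwF; rewrite inE yw orbT.
Qed.

Lemma word_filt_cat w w' :
  word_filt (w ++ w') <-> word_filt w /\ word_filt w'.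
Proof.
split=> [wwF|[wF w'F] y]; last by rewrite mem_cat => /orP[/wF|/w'F].
by split=> y yw; apply: wwF; rewrite mem_cat yw ?orbT.
Qed.

Lemma sv_word_cat w w' v : sv_word (w ++ w') v = sv_word w (sv_word w' v).
Proof. exact: foldr_cat. Qed.

Lemma sv_word_linear w : linear (sv_word w).
Proof. by move=> a u v; elim: w => //= x w ->; exact: lie_act_linearr. Qed.

Lemma sv_weight_cat w w' : sv_weight (w ++ w') = sv_weight w + sv_weight w'.
Proof. exact: big_cat. Qed.

Lemma sv_weight_cons x w : sv_weight (x :: w) = x.1 + sv_weight w.
Proof. exact: big_cons. Qed.

(* Letters of degree > n are moved to the right until they hit v; a commutator
   shortens the word without creating a new letter of degree <= n. *)
Lemma sv_word_kill (n : nat) v m w :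
  (forall x, sv_filt (n%:Z + 1) x -> rho x v = 0) ->
  word_filt w -> (count (fun x : int * g => x.1 <= n%:Z)%R w <= m)%N ->
  n%:Z * m%:Z < sv_weight w -> sv_word w v = 0.
Proof.
move=> nv; have [k] := ubnP (size w); elim: k w => // k IHk.
have step (b : seq (int * g)) : forall a (x : int * g), n%:Z < x.1 ->
    (size (a ++ x :: b) < k.+1)%N -> word_filt (a ++ x :: b) ->
    (count (fun x : int * g => x.1 <= n%:Z)%R (a ++ x :: b) <= m)%N ->
    n%:Z * m%:Z < sv_weight (a ++ x :: b) -> sv_word (a ++ x :: b) v = 0.
  elim: b => [|y b IHb] a x nx.
    move=> _ /word_filt_cat[_ /word_filt_cons[xF _]] _ _.
    rewrite sv_word_cat /= nv ?(lin0 (sv_word_linear _)) //.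
    by apply: sv_filt_le xF; lia.
  move=> abk abF abm abw.
  have /word_filt_cat[aF /word_filt_cons[xF /word_filt_cons[yF bF]]] := abF.
  rewrite sv_word_cat /= act_lie_comm (linD (sv_word_linear _)).
  move: abk abm abw; rewrite size_cat count_cat sv_weight_cat /= !sv_weight_cons.
  move=> abk abm abw.
  (* The first summand is a shorter word of the same weight, left to [IHk]; in the second [x] has
     passed [y], left to [IHb]. *)
  rewrite -[X in X + _](sv_word_cat a ((x.1 + y.1, lie x.2 y.2) :: b)).
  rewrite -[rho y.2 _]/(sv_word (y :: x :: b) v) -sv_word_cat -cat_rcons.
  rewrite IHk ?IHb ?addr0 //.
  - by rewrite size_cat size_rcons /=; lia.
  - apply/word_filt_cat; split; last exact/word_filt_cons.
    by rewrite -cats1; apply/word_filt_cat; split=> //; apply/word_filt_cons.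
  - by rewrite count_cat -cats1 count_cat /=; lia.
  - by rewrite cat_rcons sv_weight_cat !sv_weight_cons; lia.
  - by rewrite size_cat /=; lia.
  - apply/word_filt_cat; split=> //; apply/word_filt_cons; split=> //=.
    exact: sv_filt_lie.
  (* As [x.1 > n], a merged degree at most [n] forces [y.1 < 0], so [y] was counted already. *)
  - by rewrite count_cat /=; lia.
  - by rewrite sv_weight_cat !sv_weight_cons /=; lia.
move=> w wk wF wm ww.
have [/hasP[x xw nx]|wn] := boolP (has (fun x : int * g => n%:Z < x.1) w).
  by case/splitPr: xw wk wF wm ww => a b; exact: step.
have {}wn : all (fun x : int * g => x.1 <= n%:Z) w.
  by rewrite -all_predC in wn; apply: sub_all wn => x /=; rewrite -leNgt.
(* If all letters have degree at most [n], then [size w <= m] and the weight cannot exceed [n * m],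
   a contradiction. *)
have wE : sv_weight w <= n%:Z * (size w)%:Z.
  elim: w wn {wk wF wm ww} => [|x w IHw] /=; first by rewrite /sv_weight big_nil.
  by move=> /andP[xn /IHw wn]; rewrite sv_weight_cons; lia.
move: wn; rewrite all_count => /eqP wn; rewrite wn in wm.
nia.
Qed.

Lemma restricted_words : sv_restricted rho -> simple_lie_module rho ->
  exists n : nat, forall v, exists q : nat, forall s : seq g,
    (q <= size s)%N -> (forall x, x \in s -> sv_filt (n%:Z + 1) x) ->
    foldr (fun x u => rho x u) v s = 0.
Proof.
move=> rP [[v v0] simpleP]; have [n nv] := restricted_filt v rP.
exists n => w0.
(* The excess [E] may depend on the vector, which makes [N] a submodule; it contains [v] with
   [E = 0], so simplicity makes it everything. *)
pose N : set P := [set w | exists E : int, forall m wd, word_filt wd ->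
  (count (fun x : int * g => x.1 <= n%:Z)%R wd <= m)%N ->
  E + n%:Z * m%:Z < sv_weight wd -> sv_word wd w = 0].
have Nv : N v.
  by exists 0 => m wd wF wm; rewrite add0r; exact: sv_word_kill.
have subN : lie_submodule rho N.
  split=> [|a u w [E uE] [F wF]|x w [E wE]].
  - by exists 0 => m wd _ _ _; rewrite (lin0 (sv_word_linear _)).
  - exists (Order.max E F) => m wd wdF wdm wdw; rewrite sv_word_linear.
    by rewrite (uE m) ?(wF m) ?scaler0 ?addr0 //; lia.
  - have [d dx] := sv_filt_exhaustive x.
    (* Appending [x] adds [d] to the weight and at most one letter of degree at most [n], which
       costs [n] in the threshold. *)
    exists (E + n%:Z - d) => m wd wdF wdm wdw.
    rewrite -[LHS](sv_word_cat wd [:: (d, x)]); apply: (wE m.+1).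
    + by apply/word_filt_cat; split=> //; apply/word_filt_cons.
    + by rewrite count_cat /=; lia.
    + by rewrite sv_weight_cat sv_weight_cons /= [sv_weight [::]]big_nil; lia.
have NT : N = setT.
  case: (simpleP N subN) => // N0; move: Nv; rewrite N0 /= => vE.
  by rewrite vE eqxx in v0.
have [E wE] : N w0 by rewrite NT.
(* No letter has degree at most [n], so [m = 0] suffices, and the weight is at least the length,
   which exceeds [E]. *)
exists (absz E).+1 => s qs sF.
have := wE 0%N [seq (n%:Z + 1, x) | x <- s].
rewrite /sv_word foldr_map; apply.
- by move=> _ /mapP[x xs ->]; exact: sF.
- by rewrite count_map (eq_count (a2 := pred0)) ?count_pred0 // => x /=; lia.
- have -> : sv_weight [seq (n%:Z + 1, x) | x <- s] = (n%:Z + 1) * (size s)%:Z.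
    rewrite /sv_weight; elim: (s) => [|x l IHl]; first by rewrite big_nil mulr0.
    by rewrite /= big_cons IHl /=; lia.
  by nia.
Qed.

End Restricted.

(** * Passage between restrictedness and the local conditions *)

Section Equivalences.
Variables (K : numFieldType) (lambda mu : K) (P : lmodType K).
Local Notation g := (schvir lambda mu).
Variable rho : lieModule g P.

Lemma act_lspan_hull (S : set g) (s : seq P) :
  (forall u, exists s' : seq P, forall x, S x -> lspan [set` s'] (rho x u)) ->
  exists s' : seq P, forall x u, S x -> lspan [set` s] u ->
    lspan [set` s'] (rho x u).
Proof.
move=> Sfin; have [s' s'P] : exists s' : seq P, forall x u, S x -> u \in s ->
    lspan [set` s'] (rho x u).
  elim: s => [|v s [s1 s1P]]; first by exists [::].
  have [s2 s2P] := Sfin v; exists (s2 ++ s1) => x u Sx.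
  rewrite inE => /orP[/eqP ->|us]; first exact/lspan_catl/s2P.
  exact/lspan_catr/s1P.
exists s' => x u Sx; move: u; apply: lspan_min => [|u us]; last exact: s'P.
by apply: preimage_subspace (lspan_subspace _); exact: lie_act_linearr.
Qed.

Lemma words_lspan_hull (S : set g) q v :
  (forall u, exists s : seq P, forall x, S x -> lspan [set` s] (rho x u)) ->
  exists s : seq P, forall w : seq g, (size w < q)%N ->
    (forall x, x \in w -> S x) ->
    lspan [set` s] (foldr (fun x u => rho x u) v w).
Proof.
move=> Sfin; elim: q => [|q [s sP]]; first by exists [::].
have [s' s'P] := act_lspan_hull s Sfin.
exists (v :: s') => -[_ _|x w] /=; first exact/lspan_mem/mem_head.
rewrite ltnS => wq wS; apply: (@lspan_catr _ _ [:: v]).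
apply: s'P; first by apply: wS; exact: mem_head.
by apply: sP => // y yw; apply: wS; rewrite inE yw orbT.
Qed.

(** Generators shifted by [N + 2] or more have doubled degree above [N] and kill [u], so finitely
    many images remain. *)
Lemma restricted_part_fin (n : nat) : sv_restricted rho ->
  forall u, exists s : seq P, forall x, sv_part n%:Z n%:Z n%:Z x ->
    lspan [set` s] (rho x u).
Proof.
move=> rP u; have [N uN] := restricted_filt u rP.
pose s := [seq rho (svM lambda mu (n%:Z + i%:Z)) u | i <- iota 0 N.+2]
  ++ [seq rho (svY lambda mu (n%:Z + i%:Z)) u | i <- iota 0 N.+2]
  ++ [seq rho (svL lambda mu (n%:Z + i%:Z)) u | i <- iota 0 N.+2].
exists s => x; have ss := lspan_subspace [set` s]; move: x.
apply: (@lspan_min _ _ _ ((fun x => rho x u) @^-1` lspan [set` s])) => [|x [j xE]].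
  by apply: preimage_subspace ss; exact: lie_act_linearl.
rewrite /preimage /=; have [jN|Nj] := ltnP j N.+2.
  apply: lspan_mem; rewrite !mem_cat.
  have jI : j \in iota 0 N.+2 by rewrite mem_iota.
  by apply/or3P; case: xE => ->; [apply: Or31|apply: Or32|apply: Or33];
    apply/mapP; exists j.
rewrite uN; first by case: ss.
by case: xE => ->; apply: sv_filt_basis => /=; lia.
Qed.

Lemma act_powP (S : set g) n v (w : seq g) :
  size w = n -> (forall x, x \in w -> S x) ->
  act_pow rho S n v (foldr (fun x u => rho x u) v w).
Proof.
move=> <- wS; apply: sub_lspan; exists (in_tuple w); split=> // i.
by apply: wS; exact: mem_tnth.
Qed.

Lemma act_pow_min (S : set g) n v (W : set P) : subspace W ->
  (forall w : seq g, size w = n -> (forall x, x \in w -> S x) ->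
    W (foldr (fun x u => rho x u) v w)) ->
  act_pow rho S n v `<=` W.
Proof.
move=> sW wW; apply: lspan_min => // _ [w [wS ->]]; apply: wW.
  exact: size_tuple.
by move=> x /tnthP[i ->].
Qed.

Lemma act_pow_iter (S : set g) n v x : S x ->
  act_pow rho S n v (iter n (rho x) v).
Proof.
move=> Sx; have -> : iter n (rho x) v = foldr (fun x u => rho x u) v (nseq n x).
  by elim: n => //= n ->.
by apply: act_powP => [|y /nseqP[-> _]]; rewrite ?size_nseq.
Qed.

Lemma L_in_part x y z : exists2 t : nat, (0 < t)%N &
  sv_part x y z (svL lambda mu t%:Z).
Proof.
(* [|z| + 1] is positive and at least [z], whatever the sign of [z]. *)
exists (absz z).+1 => //; apply: sub_lspan; exists (absz ((absz z).+1%:Z - z)).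
by apply: Or33; congr (svL _ _ _); lia.
Qed.

Lemma elt_locally_finite_bounded u :
  elt_locally_finite rho u -> bounded_iterates (rho u).
Proof.
move=> uF v; have [s sE] := uF v; exists s => n n0.
by rewrite -sE; apply: sub_lspan; exists n.
Qed.

Lemma elt_locally_nilpotent_finite u :
  elt_locally_nilpotent rho u -> elt_locally_finite rho u.
Proof.
move=> uN v; have [q q0 vq] := uN v.
apply: (@subspace_fin_dim _ _ _ [seq iter i (rho u) v | i <- iota 0 q]).
  exact: lspan_subspace.
apply: lspan_sub => _ [n n0 <-]; have [nq|qn] := ltnP n q.
  by apply/lspan_mem/map_f; rewrite mem_iota.
rewrite -(subnK qn) iterD vq.
have -> : iter (n - q) (rho u) 0 = 0.
  by elim: (n - q)%N => //= k ->; rewrite (lin0 (lie_act_linearr rho u)).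
by case: (lspan_subspace [set` [seq iter i (rho u) v | i <- iota 0 q]]).
Qed.

Lemma locally_finite_bounded x y z : locally_finite rho (sv_part x y z) ->
  exists2 t : nat, (0 < t)%N & bounded_iterates (rho (svL lambda mu t%:Z)).
Proof.
move=> SF; have [t t0 tS] := L_in_part x y z; exists t => // v.
have [s sE] := SF v; exists s => n n0; rewrite -sE; apply: sub_lspan.
by exists n => //; exact: act_pow_iter.
Qed.

Lemma locally_nilpotent_elt x y z : locally_nilpotent rho (sv_part x y z) ->
  exists2 t : nat, (0 < t)%N & elt_locally_nilpotent rho (svL lambda mu t%:Z).
Proof.
move=> SN; have [t t0 tS] := L_in_part x y z; exists t => // v.
have [n n0 nE] := SN v; exists n => //.
by have := act_pow_iter n v tS; rewrite nE.
Qed.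

Lemma bounded_restricted (t : nat) : (0 < t)%N ->
  bounded_iterates (rho (svL lambda mu t%:Z)) -> sv_restricted rho.
Proof.
move=> t0 tb v.
have wL : witt_family (fun n => svL lambda mu n%:Z) 1 0
    (fun n => svL lambda mu n%:Z).
  move=> m n m0; rewrite (lie_basis lambda mu (GenL m) (GenL n)) /=.
  have -> : (m%:Z + n%:Z == 0) = false by lia.
  by rewrite scale0r addr0 intrD intrN mul1r addr0.
have wM : witt_family (fun n => svL lambda mu n%:Z) lambda (2 * mu)
    (fun n => svM lambda mu n%:Z).
  by move=> m n m0; rewrite (lie_basis lambda mu (GenL m) (GenM n)).
have wY : witt_family (fun n => svL lambda mu n%:Z) ((lambda + 1) / 2)
    (mu - 1 / 2) (fun n => svY lambda mu n%:Z).
  move=> m n m0; rewrite (lie_basis lambda mu (GenL m) (GenY n)) /=.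
  by rewrite addrA.
have [NL LN] := witt_family_eventually0 t0 tb wL v wL.
have [NM MN] := witt_family_eventually0 t0 tb wL v wM.
have [NY YN] := witt_family_eventually0 t0 tb wL v wY.
(* A homogeneous element of degree above this sum involves only generators whose index exceeds all
   three thresholds; positivity of the degree excludes [C]. *)
exists (NL + NM + NY)%N => k k0 u uk.
rewrite (monalgE (u : {malg K[sv_gen]})) (lin_sum (lie_act_linearl rho v)).
rewrite big_seq big1 // => j /uk.
have -> : << u@_j *g j >> = u@_j *: sv_basis lambda mu j.
  apply/malgP => l; rewrite mcoeffZ !mcoeffU.
  by case: (j == l); rewrite ?mulr1n ?mulr0n ?mulr1 ?mulr0.
rewrite (linZ (lie_act_linearl rho v)); rewrite sv_degreeE => jE.
have {jE} jE : sv_deg2 j = 2 * (NL + NM + NY)%N%:Z + k%:Z.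
  apply: (@intr_inj rat); rewrite -[LHS](divfK (_ : 2 != 0)) // jE.
  by rewrite intrD intrM; field.
have actE y : rho y v = 0 -> u@_j *: rho y v = 0 by move=> ->; rewrite scaler0.
apply: actE; case: j jE => [m|m|m|] /= jE.
- by rewrite (_ : m = (absz m)%:Z); [apply: LN|]; lia.
- by rewrite (_ : m = (absz m)%:Z); [apply: MN|]; lia.
- by rewrite (_ : m = (absz m)%:Z); [apply: YN|]; lia.
- by lia.
Qed.

(** Long words vanish by [restricted_words], and short ones stay in a finite-dimensional space by
    [words_lspan_hull]; this gives both properties for the same part. *)
Lemma restricted_locally_nilpotent : simple_lie_module rho ->
  sv_restricted rho -> exists n : nat,
    locally_nilpotent rho (sv_part n%:Z n%:Z n%:Z) /\
    locally_finite rho (sv_part n%:Z n%:Z n%:Z).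
Proof.
move=> simpleP rP; have [n nP] := restricted_words rP simpleP.
have SF : sv_part n.+1%:Z n.+1%:Z n.+1%:Z `<=` @sv_filt _ lambda mu (n%:Z + 1).
  by apply: sv_part_filt; lia.
exists n.+1; split=> v; have [q qP] := nP v.
  exists q.+1 => //; apply/seteqP; split=> [|_ ->]; last first.
    by case: (lspan_subspace [set w | exists s : q.+1.-tuple g,
     (forall i, sv_part n.+1%:Z n.+1%:Z n.+1%:Z (tnth s i)) /\
     w = foldr (fun x u => rho x u) v s]).
  apply: act_pow_min => [|w wq wS].
    by split=> // a u w /= -> ->; rewrite scaler0 addr0.
  by rewrite /= qP ?wq // => x /wS; exact: SF.
have [s sP] := words_lspan_hull q v (restricted_part_fin n.+1 rP).
apply: (@subspace_fin_dim _ _ _ s); first exact: lspan_subspace.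
apply: lspan_sub => u [k k0]; move: u; apply: act_pow_min => [|w wk wS].
  exact: lspan_subspace.
have [wq|qw] := ltnP (size w) q; first exact: sP.
rewrite qP // => [|x /wS]; last exact: SF.
by case: (lspan_subspace [set` s]).
Qed.

End Equivalences.

Theorem theorem3p7 (R : realType) (lambda mu : R[i]) (P : lmodType R[i])
    (rho : lieModule (schvir lambda mu) P)
    (c : R[i]) (C_scalar : forall v : P, rho (svC lambda mu) v = c *: v)
    (simpleP : simple_lie_module rho) :
  [<-> exists2 t : nat, (0 < t)%N & elt_locally_finite rho (svL lambda mu t%:Z);
       exists2 t : nat, (0 < t)%N & elt_locally_nilpotent rho (svL lambda mu t%:Z);
       exists x y z : int, locally_finite rho (sv_part x y z);
       exists x y z : int, locally_nilpotent rho (sv_part x y z);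
       sv_restricted rho].
Proof.
have r_part := restricted_locally_nilpotent simpleP.
have fin_r t : (0 < t)%N -> elt_locally_finite rho (svL lambda mu t%:Z) ->
    sv_restricted rho.
  by move=> t0 /elt_locally_finite_bounded; exact: bounded_restricted.
have nil_r t : (0 < t)%N -> elt_locally_nilpotent rho (svL lambda mu t%:Z) ->
    sv_restricted rho.
  by move=> t0 /elt_locally_nilpotent_finite; exact: fin_r.
have r_nil : sv_restricted rho -> exists2 t : nat, (0 < t)%N &
    elt_locally_nilpotent rho (svL lambda mu t%:Z).
  by move=> /r_part[n [nN _]]; exact: locally_nilpotent_elt nN.
(* Each implication of the cycle passes through restrictedness. *)
tfae.
- by move=> [t t0 /(fin_r t t0)/r_nil].
- by move=> [t t0 /(nil_r t t0)/r_part[n [_ nF]]]; exists n, n, n.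
- move=> [x [y [z /locally_finite_bounded[t t0 tb]]]].
  by have /r_part[n [nN _]] := bounded_restricted t0 tb; exists n, n, n.
- by move=> [x [y [z /locally_nilpotent_elt[t t0 /(nil_r t t0)]]]].
- by move=> /r_nil[t t0 tN]; exists t => //; exact: elt_locally_nilpotent_finite.
Qed.
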